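(* Let $\pi\colon X\to B$ be an étale bundle such that $B$ is a sober space. Then \[T_{\Gamma(\pi)}\cong\mathbf{La}(\pi),\] where $T_{\Gamma(\pi)}$ is the generalised Munn semigroup of the presheaf (sheaf) of sections $(\Gamma(\pi),\Omega(B),p)$ of $\pi$, and $\mathbf{La}(\pi)$ is the inverse semigroup of principal partial automorphisms of $\pi$.
   Context: An étale bundle is a surjective local homeomorphism $\pi\colon X\to B$ of topological spaces. $\Omega(B)$ is the frame of open sets of $B$, a meet-semilattice under intersection. $B$ is sober if every completely prime filter in $\Omega(B)$ is the neighbourhood filter of a unique point. A (local) section of $\pi$ is a continuous map $\sigma\colon U\to X$ with $U\subseteq B$ open and $\pi\sigma=\mathrm{Id}_U$. $\Gamma(\pi)$ is the set of all local sections. It is a presheaf $(\Gamma(\pi),\Omega(B),p)$ over $\Omega(B)$ via $\sigma\cdot V=\sigma|_{V\cap U}$ for $\sigma\colon U\to X$, $V\in\Omega(B)$, and $p(\sigma)=\operatorname{dom}\sigma$. Generally, a presheaf $(Y,E,p)$ over a meet-semilattice $E$ (commutative semigroup of idempotents) consists of a set $Y$, an action $Y\times E\to Y$ and a map $p\colon Y\to E$ with $(y\cdot e)\cdot f=y\cdot ef$, $y\cdot p(y)=y$, $p(y\cdot e)=p(y)e$. The partial order on $Y$ is $x\le y\iff x=y\cdot p(x)$. For $e\in E$ put $e^{\downarrow}=\{f\in E: f\le e\}$ and $Y\cdot e=\{y\in Y:p(y)\le e\}$. The generalised Munn semigroup $T_Y$ consists of all pairs $(\alpha,\theta)$ of order-isomorphisms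 $\alpha\colon Y\cdot e\to Y\cdot f$, $\theta\colon e^{\downarrow}\to f^{\downarrow}$ ($e,f\in E$) with $p(\alpha(y))=\theta(p(y))$ for all $y\in Y\cdot e$, under componentwise composition of partial bijections; it is an inverse semigroup. A principal partial automorphism of $\pi$ is a pair of homeomorphisms $(\theta\colon\pi^{-1}(U)\to\pi^{-1}(V),\ \hat\theta\colon U\to V)$, with $U,V\subseteq B$ open, such that $\pi\theta=\hat\theta\pi$ on $\pi^{-1}(U)$. $\mathbf{La}(\pi)$ is the inverse semigroup of all of these under componentwise composition of partial homeomorphisms. *)

(* Defs.v *)
From HB Require Import structures.
From mathcomp Require Import all_boot all_order.
From mathcomp Require Import all_classical.
From mathcomp Require Import topology.

Set Implicit Arguments.
Unset Strict Implicit.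
Unset Printing Implicit Defensive.

Import Order.LTheory.

Local Open Scope classical_set_scope.

HB.mixin Record Semigroup_isInverse G of Semigroup G := {
  inverse_semigroupP : forall x : G,
    exists! y : G, (x * y * x = x /\ y * x * y = y)%g
}.

#[short(type="inverseSemigroupType")]
HB.structure Definition InverseSemigroup :=
  {G of Semigroup_isInverse G & Semigroup G}.

(* A partial map from [A] to [B] is encoded as a function [A -> option B], so
   that extensionally equal partial maps are equal.  [pcomp f g] is f after g,
   defined wherever both steps are. *)

Section PartialMaps.
Context {A B : Type}.
Implicit Types (f : A -> option B) (g : B -> option A).

Definition pdom f : set A := [set x | exists y, f x = Some y].

Definition prange f : set B := [set y | exists x, f x = Some y].

Definition partial_inverse f g := forall x y, f x = Some y <-> g y = Some x.

(* equivalently, f is a bijection from pdom f onto prange f *)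
Definition pinjective f :=
  forall x x' y, f x = Some y -> f x' = Some y -> x = x'.

Definition prestrict (U : set A) f : A -> option B :=
  fun x => if `[< U x >] then f x else None.

Definition pinv f : B -> option A := fun y =>
  if pselect (exists x, f x = Some y) is left h then Some (projT1 (cid h))
  else None.

Lemma prestrictP U f x y : prestrict U f x = Some y <-> U x /\ f x = Some y.
Proof. by rewrite /prestrict; case: asboolP => Ux; split=> // -[]. Qed.

Lemma pinvP f : pinjective f -> partial_inverse f (pinv f).
Proof.
move=> fI x y; rewrite /pinv; case: pselect => [h|nh]; last first.
  by split=> // fxy; case: nh; exists x.
case: (cid h) => x' /= fx'; split=> [fx|[<-]//].
by rewrite (fI _ _ _ fx fx').
Qed.

Lemma partial_inverse_inj f g : partial_inverse f g -> pinjective f.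
Proof. by move=> fg x x' y /fg + /fg => -> []. Qed.

End PartialMaps.

Section PartialMapsTheory.

Lemma partial_inverseC A B (f : A -> option B) g :
  partial_inverse f g -> partial_inverse g f.
Proof. by move=> fg x y; symmetry; apply: fg. Qed.

Lemma partial_inverse_dom A B (f : A -> option B) g :
  partial_inverse f g -> pdom g = prange f.
Proof. by move=> fg; apply/seteqP; split=> y [x /fg h]; exists x. Qed.

Lemma partial_inverse_range A B (f : A -> option B) g :
  partial_inverse f g -> prange g = pdom f.
Proof. by move=> /partial_inverseC /partial_inverse_dom ->. Qed.

Lemma peq A B (f f' : A -> option B) :
  (forall x y, f x = Some y <-> f' x = Some y) -> f = f'.
Proof.
move=> ff'; apply/funext => x; case e : (f x) => [y|]; first by rewrite (ff' x y).1.
by case e' : (f' x) => [y|//]; rewrite -e (ff' x y).2.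
Qed.

Lemma pcompP A B C (f : B -> option C) (g : A -> option B) x z :
  pcomp f g x = Some z <-> exists2 y, g x = Some y & f y = Some z.
Proof.
rewrite /pcomp; case: (g x) => [y|] /=; last by split=> // -[].
by split=> [fy|[_ [<-]]//]; exists y.
Qed.

Lemma pcompA A B C D (f : C -> option D) (g : B -> option C)
    (h : A -> option B) : pcomp f (pcomp g h) = pcomp (pcomp f g) h.
Proof. by apply/funext => x; rewrite /pcomp; case: (h x). Qed.

Lemma pcomp_inj A B C (f : B -> option C) (g : A -> option B) :
  pinjective f -> pinjective g -> pinjective (pcomp f g).
Proof.
move=> fI gI x x' z /pcompP[y gx fy] /pcompP[y' gx' fy'].
by apply: (gI _ _ y) => //; rewrite (fI _ _ _ fy fy').
Qed.

Lemma pcomp_partial_inverse A B C (f : B -> option C) (g : A -> option B) f' g' :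
  partial_inverse f f' -> partial_inverse g g' ->
  partial_inverse (pcomp f g) (pcomp g' f').
Proof.
move=> ff' gg' x z; split=> /pcompP[y].
  by move=> /gg' ? /ff' ?; apply/pcompP; exists y.
by move=> /ff' ? /gg' ?; apply/pcompP; exists y.
Qed.

Lemma partial_inverseKK A B (f : A -> option B) g :
  partial_inverse f g -> pcomp (pcomp f g) f = f.
Proof.
move=> fg; apply: peq => x y; split=> [/pcompP[z fx /pcompP[x' gz fx']]|fx].
  by move/fg: gz; move: (fx') => ->; rewrite fx => -[->].
apply/pcompP; exists y => //; apply/pcompP; exists x => //; exact/fg.
Qed.

Lemma pseudo_inverse_unique A (f g g' : A -> option A) :
  pinjective f -> pinjective g -> partial_inverse f g' ->
  pcomp (pcomp f g) f = f -> pcomp (pcomp g f) g = g -> g' = g.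
Proof.
move=> fI gI fg' fgf gfg; apply: peq => y x; split.
  move=> /fg' fx; move: (fx); rewrite -{1}fgf => /pcompP[y' fx'].
  move: fx'; rewrite fx => -[<-] /pcompP[x' gy fx'].
  by rewrite gy (fI _ _ _ fx fx').
move=> gy; apply/fg'; move: (gy); rewrite -{1}gfg => /pcompP[x' gy'].
move: gy'; rewrite gy => -[<-] /pcompP[y' fx gy'].
by rewrite fx (gI _ _ _ gy gy').
Qed.

End PartialMapsTheory.

(* [pact y e] is the restriction y . e, and [psupp] is the structure map p. *)
Record presheaf d (E : meetSemilatticeType d) := Presheaf {
  psections :> Type;
  pact : psections -> E -> psections;
  psupp : psections -> E;
  pactA : forall y e f, pact (pact y e) f = pact y (e `&` f)%O;
  pact_supp : forall y, pact y (psupp y) = y;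
  psupp_act : forall y e, psupp (pact y e) = (psupp y `&` e)%O
}.

Definition presheaf_le d (E : meetSemilatticeType d) (Y : presheaf E)
  (x y : Y) : Prop := x = pact y (psupp x).

Definition presheaf_below d (E : meetSemilatticeType d) (Y : presheaf E)
  (e : E) : set Y := [set y | (psupp y <= e)%O].

Definition principal_ideal d (E : meetSemilatticeType d) (e : E) : set E :=
  [set f | (f <= e)%O].

Section PartialOrderIso.
Context {A : Type} (le : A -> A -> Prop).

Definition partial_order_iso (S S' : set A) (f : A -> option A) : Prop :=
  [/\ pdom f = S, prange f = S', pinjective f &
      forall x y x' y', f x = Some x' -> f y = Some y' ->
        le x y <-> le x' y'].

Lemma partial_order_iso_inv S S' f g : partial_inverse f g ->
  partial_order_iso S S' f -> partial_order_iso S' S g.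
Proof.
move=> fg [<- <- _ fle]; split.
- exact: partial_inverse_dom.
- exact: partial_inverse_range.
- exact/partial_inverse_inj/partial_inverseC.
- by move=> x y x' y' /fg fx /fg fy; symmetry; apply: fle.
Qed.

End PartialOrderIso.

Section Munn.
Context {d} {E : meetSemilatticeType d} (Y : presheaf E).
Implicit Types (a b : Y -> option Y) (t u : E -> option E).

(* The elements e and f are not part of the data: they are the largest elements
   of the domain and range of t. *)
Definition is_munn a t : Prop := exists e f : E,
  [/\ partial_order_iso (@presheaf_le d E Y) (presheaf_below e)
        (presheaf_below f) a,
      partial_order_iso (fun g h : E => (g <= h)%O) (principal_ideal e)
        (principal_ideal f) t &
      forall y : Y, presheaf_below e y -> omap (@psupp d E Y) (a y) = t (psupp y)].

Record munn := Munn {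
  munn_sections : Y -> option Y;
  munn_index : E -> option E;
  munnP : is_munn munn_sections munn_index
}.

Lemma munn_eq (x y : munn) : munn_sections x = munn_sections y ->
  munn_index x = munn_index y -> x = y.
Proof.
case: x y => [a t p] [b u q] /= ab tu; rewrite ab tu in p *.
by rewrite (Prop_irrelevance p q).
Qed.

Lemma is_munn_inv a t b u : partial_inverse a b -> partial_inverse t u ->
  is_munn a t -> is_munn b u.
Proof.
move=> ab tu [e [f [ai ti at_]]]; exists f, e; split.
- exact: partial_order_iso_inv ab ai.
- exact: partial_order_iso_inv tu ti.
- move=> y yf; case: ai => ad ar _ _.
  have [x ax] : prange a y by rewrite ar.
  have xe : presheaf_below e x by rewrite -ad; exists y.
  have := at_ x xe; rewrite ax /= => /esym /tu ->.
  by rewrite (iffLR (ab x y) ax).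
Qed.

Lemma is_munn_comp a t b u : is_munn a t -> is_munn b u ->
  is_munn (pcomp a b) (pcomp t u).
Proof.
move=> [e1 [f1 [[ad ar aI ale] [td tr tI tle] at_]]].
move=> [e2 [f2 [[bd br bI ble] [ud ur uI ule] bu]]].
pose g := (f2 `&` e1)%O.
have [h uh] : prange u g by rewrite ur /principal_ideal /= leIl.
have [k tk] : pdom t g by rewrite td /principal_ideal /= leIr.
have he : (h <= e2)%O by have : pdom u h; [exists g|rewrite ud].
have kf : (k <= f1)%O by have : prange t k; [exists g|rewrite tr].
have udh x : (x <= h)%O -> exists2 y, u x = Some y & (y <= g)%O.
  move=> xh; have [y uy] : pdom u x.
    by rewrite ud /principal_ideal /= (le_trans xh).
  by exists y => //; apply/(ule _ _ _ _ uy uh).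
have udh' x y : u x = Some y -> (y <= e1)%O -> (x <= h)%O.
  move=> uy ye; apply/(ule _ _ _ _ uy uh); rewrite /g lexI ye andbT.
  by have : prange u y; [exists x|rewrite ur].
have tdk z : (z <= k)%O -> exists2 y, t y = Some z & (y <= g)%O.
  move=> zk; have [y ty] : prange t z.
    by rewrite tr /principal_ideal /= (le_trans zk).
  by exists y => //; apply/(tle _ _ _ _ ty tk).
have tdk' y z : t y = Some z -> (y <= f2)%O -> (z <= k)%O.
  move=> ty yf; apply/(tle _ _ _ _ ty tk); rewrite /g lexI yf /=.
  by have : pdom t y; [exists z|rewrite td].
have gf : (g <= f2)%O by rewrite leIl.
have ge : (g <= e1)%O by rewrite leIr.
have bE y y' : b y = Some y' -> u (psupp y) = Some (psupp y').
  by move=> by_; rewrite -bu ?by_// -bd; exists y'.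
have aE y y' : a y = Some y' -> t (psupp y) = Some (psupp y').
  by move=> ay_; rewrite -at_ ?ay_// -ad; exists y'.
exists h, k; split.
- split.
  + apply/seteqP; split=> y.
      move=> [z /pcompP[y' by_ ay]]; apply: (udh' _ _ (bE _ _ by_)).
      by have : pdom a y'; [exists z|rewrite ad].
    move=> yh; have [y' by_] : pdom b y.
      by rewrite bd /presheaf_below /= (le_trans yh).
    have [w] := udh _ yh; rewrite (bE _ _ by_) => -[<-] yg.
    have [z az] : pdom a y'.
      by rewrite ad /presheaf_below /= (le_trans yg).
    by exists z; apply/pcompP; exists y'.
  + apply/seteqP; split=> z.
      move=> [y /pcompP[y' by_ ay]]; apply: (tdk' _ _ (aE _ _ ay)).
      by have : prange b y'; [exists y|rewrite br].
    move=> zk; have [y' ay] : prange a z.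
      by rewrite ar /presheaf_below /= (le_trans zk).
    have [w tw wg] := tdk _ zk; have e : psupp y' = w by exact: tI (aE _ _ ay) tw.
    have [y by_] : prange b y'.
      by rewrite br /presheaf_below /= e (le_trans wg).
    by exists y; apply/pcompP; exists y'.
  + exact: pcomp_inj.
  + move=> x y x'' y'' /pcompP[x' bx ax] /pcompP[y' by_ ay].
    by rewrite (ble _ _ _ _ bx by_); apply: ale.
- split.
  + apply/seteqP; split=> x.
      move=> [z /pcompP[y ux ty]]; apply: (udh' _ _ ux).
      by have : pdom t y; [exists z|rewrite td].
    move=> /udh[y ux yg]; have [z ty] : pdom t y.
      by rewrite td /principal_ideal /= (le_trans yg).
    by exists z; apply/pcompP; exists y.
  + apply/seteqP; split=> z.
      move=> [x /pcompP[y ux ty]]; apply: (tdk' _ _ ty).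
      by have : prange u y; [exists x|rewrite ur].
    move=> /tdk[y ty yg]; have [x ux] : prange u y.
      by rewrite ur /principal_ideal /= (le_trans yg).
    by exists x; apply/pcompP; exists y.
  + exact: pcomp_inj.
  + move=> x y x'' y'' /pcompP[x' bx ax] /pcompP[y' by_ ay].
    by rewrite (ule _ _ _ _ bx by_); apply: tle.
- move=> y yh; have [y' by_] : pdom b y.
    by rewrite bd /presheaf_below /= (le_trans yh).
  have [w] := udh _ yh; rewrite /pcomp (bE _ _ by_) by_ => -[<-] yg /=.
  by apply: at_; rewrite /presheaf_below /= (le_trans yg).
Qed.

(* componentwise composition, the right factor being applied first *)
Definition munn_mul (x y : munn) : munn :=
  Munn (is_munn_comp (munnP x) (munnP y)).

Lemma munn_mulA : associative munn_mul.
Proof. by move=> x y z; apply: munn_eq => /=; rewrite pcompA. Qed.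

HB.instance Definition _ := gen_eqMixin munn.
HB.instance Definition _ := gen_choiceMixin munn.
HB.instance Definition _ := isSemigroup.Build munn munn_mulA.

Lemma munn_inverse_semigroup (x : munn) :
  exists! y : munn, (x * y * x = x /\ y * x * y = y)%g.
Proof.
have inj (z : munn) : pinjective (munn_sections z) /\ pinjective (munn_index z).
  by case: z => a t /= [e [f [[_ _ ? _] [_ _ ? _] _]]].
have [aI tI] := inj x.
have ab := pinvP aI; have tu := pinvP tI.
exists (Munn (is_munn_inv ab tu (munnP x))); split.
  split; apply: munn_eq => /=.
  - exact: partial_inverseKK ab.
  - exact: partial_inverseKK tu.
  - exact: partial_inverseKK (partial_inverseC ab).
  - exact: partial_inverseKK (partial_inverseC tu).
move=> y [xyx yxy]; have [bI uI] := inj y.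
apply: munn_eq => /=.
- by apply: pseudo_inverse_unique aI bI ab _ _;
    [rewrite -{3}xyx | rewrite -{3}yxy].
- by apply: pseudo_inverse_unique tI uI tu _ _;
    [rewrite -{3}xyx | rewrite -{3}yxy].
Qed.

HB.instance Definition _ := Semigroup_isInverse.Build munn munn_inverse_semigroup.

End Munn.

Section PartialContinuity.
Context {S T : topologicalType}.
Implicit Types (f : S -> option T).

(* the total map pdom f -> T underlying f is continuous, pdom f carrying the
   subspace topology *)
Definition pcontinuous f : Prop :=
  exists2 g : pdom f -> T, forall x : pdom f, f (\val x) = Some (g x)
    & continuous g.

Lemma pcontinuousP f : pcontinuous f <->
  forall O : set T, open O -> exists2 W : set S, open W &
    [set x | exists2 y, f x = Some y & O y] = pdom f `&` W.
Proof.
split=> [[g fg /continuousP gc] O /gc[W oW WE]|fc].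
  exists W => //; apply/seteqP; split=> x.
    move=> [y fx Oy]; have xd : pdom f x by exists y.
    split=> //; pose x' : pdom f := exist _ x (mem_set xd).
    have : (g @^-1` O) x'.
      by have := fg x'; rewrite /= fx => -[<-].
    by rewrite -WE.
  move=> [xd Wx]; pose x' : pdom f := exist _ x (mem_set xd).
  exists (g x'); first exact: (fg x').
  by have : (set_val @^-1` W) x' by []; rewrite WE.
have fd (x : pdom f) : {y | f (\val x) = Some y}.
  by apply/cid; case: x => x /= /set_mem.
exists (fun x => projT1 (fd x)) => [x|]; first by case: (fd x).
apply/continuousP => O /fc[W oW WE]; exists W => //.
apply/seteqP; split=> -[x xd] /=; set y := fd _; case: y => y /= fy.
  move=> Wx; have : (pdom f `&` W) x by split=> //; exact: set_mem.
  by rewrite -WE => -[y']; rewrite fy => -[->].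
move=> Oy; have : [set x | exists2 y, f x = Some y & O y] x by exists y.
by rewrite WE => -[].
Qed.

Lemma pcontinuous_open f O : pcontinuous f -> open (pdom f) -> open O ->
  open [set x | exists2 y, f x = Some y & O y].
Proof. by move=> /pcontinuousP fc od /fc[W oW ->]; exact: openI. Qed.

End PartialContinuity.

Definition partial_homeo (S T : topologicalType) (U : set S) (V : set T)
    (f : S -> option T) : Prop :=
  [/\ pdom f = U, prange f = V, pcontinuous f &
      exists2 g, partial_inverse f g & pcontinuous g].

Section PartialHomeoTheory.
Context {S T Z : topologicalType}.

Lemma pcontinuous_comp (f : T -> option Z) (g : S -> option T) :
  pcontinuous f -> pcontinuous g -> pcontinuous (pcomp f g).
Proof.
move=> /pcontinuousP fc /pcontinuousP gc; apply/pcontinuousP => O /fc[W oW WE].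
have [W' oW' W'E] := gc _ oW; exists W' => //; apply/seteqP; split=> x.
  move=> [z /pcompP[y gx fy] Oz]; split; first by exists z; apply/pcompP; exists y.
  have : (pdom f `&` W) y by rewrite -WE; exists z.
  move=> [_ Wy]; have : (pdom g `&` W') x by rewrite -W'E; exists y.
  by case.
move=> [[z /pcompP[y gx fy]] W'x].
have : (pdom g `&` W') x by split=> //; exists y.
rewrite -W'E => -[y']; rewrite gx => -[<-] Wy.
have : (pdom f `&` W) y by split=> //; exists z.
rewrite -WE => -[z' fy' Oz]; exists z' => //; apply/pcompP; by exists y.
Qed.

Lemma partial_homeo_inv U V (f : S -> option T) g : partial_inverse f g ->
  partial_homeo U V f -> partial_homeo V U g.
Proof.
move=> fg [<- <- fc [g' fg' gc]]; have gg' : g = g'.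
  by apply: peq => y x; rewrite -fg fg'.
split.
- exact: partial_inverse_dom.
- exact: partial_inverse_range.
- by rewrite gg'.
- by exists f => //; exact: partial_inverseC.
Qed.

Lemma partial_homeo_inj U V (f : S -> option T) :
  partial_homeo U V f -> pinjective f.
Proof. by move=> [_ _ _ [g /partial_inverse_inj]]. Qed.

Lemma partial_homeo_comp U V (f : T -> option Z) (g : S -> option T) :
  pdom (pcomp f g) = U -> prange (pcomp f g) = V ->
  (exists U' V', partial_homeo U' V' f) ->
  (exists U' V', partial_homeo U' V' g) -> partial_homeo U V (pcomp f g).
Proof.
move=> dE rE [? [? [_ _ fc [f' ff' f'c]]]] [? [? [_ _ gc [g' gg' g'c]]]].
split=> //; first exact: pcontinuous_comp.
exists (pcomp g' f'); first exact: pcomp_partial_inverse.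
rewrite /pcontinuous.
move: f' g' ff' gg' f'c g'c => f' g' ff' gg' f'c g'c.
move/pcontinuousP: f'c => f'c; move/pcontinuousP: g'c => g'c.
apply/pcontinuousP => O /g'c[W oW WE].
have [W' oW' W'E] := f'c _ oW; exists W' => //; apply/seteqP; split=> x.
  move=> [z /pcompP[y gx fy] Oz]; split; first by exists z; apply/pcompP; exists y.
  have : (pdom g' `&` W) y by rewrite -WE; exists z.
  move=> [_ Wy]; have : (pdom f' `&` W') x by rewrite -W'E; exists y.
  by case.
move=> [[z /pcompP[y gx fy]] W'x].
have : (pdom f' `&` W') x by split=> //; exists y.
rewrite -W'E => -[y']; rewrite gx => -[<-] Wy.
have : (pdom g' `&` W) y by split=> //; exists z.
rewrite -WE => -[z' fy' Oz]; exists z' => //; apply/pcompP; by exists y.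
Qed.

End PartialHomeoTheory.

Fact opens_display : Order.disp_t. Proof. by []. Qed.

Definition opens (B : topologicalType) : Type := set_type (@open B).

Definition opens_set (B : topologicalType) (U : opens B) : set B := \val U.
Coercion opens_set : opens >-> set.

Section Opens.
Context {B : topologicalType}.

HB.instance Definition _ := SubChoice.on (opens B).

Lemma opens_meet_closed : Order.ClosedPredicates.meet_closed (fun U : set B => U \in @open B).
Proof.
move=> U V /set_mem oU /set_mem oV; apply/mem_set.
by rewrite meetEset; exact: openI.
Qed.

Lemma opens_join_closed : Order.ClosedPredicates.join_closed (fun U : set B => U \in @open B).
Proof.
move=> U V /set_mem oU /set_mem oV; apply/mem_set.
by rewrite joinEset; exact: openU.
Qed.

(* ordered by inclusion, with intersections as meets and unions as joins *)
HB.instance Definition _ := Order.SubChoice_isSubLattice.Build _ (set B)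
  (fun U : set B => U \in @open B) opens_display (opens B)
  opens_meet_closed opens_join_closed.

Lemma opens_eq (U V : opens B) : U = V :> set B -> U = V.
Proof. exact: val_inj. Qed.

Lemma opens_open (U : opens B) : open (U : set B).
Proof. exact: set_mem (valP U). Qed.

Lemma opens_le (U V : opens B) : (U <= V)%O = ((U : set B) `<=` V) :> Prop.
Proof. by rewrite -subsetEset. Qed.

Lemma opens_meet (U V : opens B) : opens_set (U `&` V)%O = (U : set B) `&` V.
Proof. by []. Qed.

Definition mk_opens (U : set B) (oU : open U) : opens B :=
  exist _ U (mem_set oU).

(* Joins in the frame of open sets are unions; taking C empty shows that F does
   not contain the empty set. *)
Definition completely_prime_filter (F : set (opens B)) : Prop :=
  [/\ F !=set0,
      forall U V : opens B, (U <= V)%O -> F U -> F V,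
      forall U V : opens B, F U -> F V -> F (U `&` V)%O &
      forall (C : set (opens B)) (W : opens B),
        (W : set B) = \bigcup_(U in C) (U : set B) -> F W ->
        exists2 U, C U & F U].

Definition nbhs_filter (b : B) : set (opens B) :=
  [set U : opens B | (U : set B) b].

End Opens.

Definition sober (B : topologicalType) : Prop :=
  forall F : set (opens B), completely_prime_filter F ->
    exists! b : B, F = nbhs_filter b.

Definition local_homeomorphism (X B : topologicalType) (pi : X -> B) : Prop :=
  forall x : X, exists W : set X,
    [/\ open W, W x, open (pi @` W) &
        partial_homeo W (pi @` W) (prestrict W (Some \o pi))].

Definition etale_bundle (X B : topologicalType) (pi : X -> B) : Prop :=
  (forall b : B, exists x : X, pi x = b) /\ local_homeomorphism pi.

Section Bundle.
Context {X B : topologicalType} (pi : X -> B).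

Record local_section := LocalSection {
  section_map :> B -> option X;
  section_open : open (pdom section_map);
  section_continuous : pcontinuous section_map;
  section_id : forall b x, section_map b = Some x -> pi x = b
}.

Lemma local_section_eq (s t : local_section) :
  (s : B -> option X) = t -> s = t.
Proof.
case: s t => [s so sc si] [t to tc ti] /= st; rewrite st in so sc si *.
by rewrite (Prop_irrelevance so to) (Prop_irrelevance sc tc)
           (Prop_irrelevance si ti).
Qed.

Lemma pdom_prestrict (V : set B) (s : B -> option X) :
  pdom (prestrict V s) = V `&` pdom s.
Proof.
apply/seteqP; split=> b; first by move=> [x /prestrictP[Vb sb]]; split=> //; exists x.
by move=> [Vb [x sb]]; exists x; apply/prestrictP.
Qed.

Fact section_restrict_open (s : local_section) (V : opens B) :
  open (pdom (prestrict V s)).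
Proof.
by rewrite pdom_prestrict; apply: openI; [exact: opens_open|exact: section_open].
Qed.

Fact section_restrict_continuous (s : local_section) (V : opens B) :
  pcontinuous (prestrict V s).
Proof.
have /pcontinuousP sc := section_continuous s; apply/pcontinuousP => O /sc[W oW WE].
exists W => //; rewrite pdom_prestrict -setIA -WE; apply/seteqP; split=> b.
  by move=> [x /prestrictP[Vb sb] Ox]; split=> //; exists x.
by move=> [Vb [x sb Ox]]; exists x => //; apply/prestrictP.
Qed.

Fact section_restrict_id (s : local_section) (V : opens B) b x :
  prestrict V s b = Some x -> pi x = b.
Proof. by move=> /prestrictP[_]; exact: section_id. Qed.

Definition section_restrict (s : local_section) (V : opens B) : local_section :=
  LocalSection (section_restrict_open s V) (section_restrict_continuous s V)
    (@section_restrict_id s V).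

Definition section_dom (s : local_section) : opens B :=
  mk_opens (section_open s).

Fact section_restrictA s (U V : opens B) :
  section_restrict (section_restrict s U) V = section_restrict s (U `&` V)%O.
Proof.
apply: local_section_eq; apply: peq => b x /=; split.
  by move=> /prestrictP[Vb /prestrictP[Ub sb]]; apply/prestrictP; rewrite opens_meet.
move=> /prestrictP[]; rewrite opens_meet => -[Ub Vb] sb.
by apply/prestrictP; split=> //; apply/prestrictP.
Qed.

Fact section_restrict_dom s : section_restrict s (section_dom s) = s.
Proof.
apply: local_section_eq; apply: peq => b x /=; split; first by case/prestrictP.
by move=> sb; apply/prestrictP; split=> //; exists x.
Qed.

Fact section_dom_restrict s (V : opens B) :
  section_dom (section_restrict s V) = (section_dom s `&` V)%O.
Proof. by apply: opens_eq; rewrite opens_meet /= setIC -pdom_prestrict. Qed.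

Definition section_presheaf : presheaf (opens B) :=
  Presheaf section_restrictA section_restrict_dom section_dom_restrict.

(* U and V are the domain and range of h, hence not part of the data. *)
Definition is_ppaut (t : X -> option X) (h : B -> option B) : Prop :=
  exists U V : set B,
    [/\ open U, open V, partial_homeo (pi @^-1` U) (pi @^-1` V) t,
        partial_homeo U V h &
        forall x, (pi @^-1` U) x -> omap pi (t x) = h (pi x)].

Record ppaut := PPAut {
  ppaut_total : X -> option X;
  ppaut_base : B -> option B;
  ppautP : is_ppaut ppaut_total ppaut_base
}.

Lemma ppaut_eq (x y : ppaut) : ppaut_total x = ppaut_total y ->
  ppaut_base x = ppaut_base y -> x = y.
Proof.
case: x y => [a t p] [b u q] /= ab tu; rewrite ab tu in p *.
by rewrite (Prop_irrelevance p q).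
Qed.

Lemma is_ppaut_inv a t b u : partial_inverse a b -> partial_inverse t u ->
  is_ppaut a t -> is_ppaut b u.
Proof.
move=> ab tu [U [V [oU oV ah th at_]]]; exists V, U; split=> //.
- exact: partial_homeo_inv ab ah.
- exact: partial_homeo_inv tu th.
- move=> y Vy; case: ah => ad ar _ _.
  have [x ax] : prange a y by rewrite ar.
  have Ux : (pi @^-1` U) x by rewrite -ad; exists y.
  have := at_ x Ux; rewrite ax /= => /esym /tu ->.
  by rewrite (iffLR (ab x y) ax).
Qed.

Lemma is_ppaut_comp a t b u : is_ppaut a t -> is_ppaut b u ->
  is_ppaut (pcomp a b) (pcomp t u).
Proof.
move=> [U1 [V1 [oU1 oV1 ah th at_]]] [U2 [V2 [oU2 oV2 bh uh bu]]].
have [ad ar ac [a' aa' a'c]] := ah; have [td tr tc [t' tt' t'c]] := th.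
have [bd br bc _] := bh; have [ud ur uc _] := uh.
have aI := partial_inverse_inj aa'; have tI := partial_inverse_inj tt'.
pose U := [set c | exists2 c', u c = Some c' & U1 c'].
pose V := [set c | exists2 c', t' c = Some c' & V2 c'].
have oU : open U by apply: pcontinuous_open => //; rewrite ud.
have oV : open V.
  by apply: pcontinuous_open => //; rewrite (partial_inverse_dom tt') tr.
have bE y y' : b y = Some y' -> u (pi y) = Some (pi y').
  by move=> by_; rewrite -bu ?by_// -bd; exists y'.
have aE y y' : a y = Some y' -> t (pi y) = Some (pi y').
  by move=> ay_; rewrite -at_ ?ay_// -ad; exists y'.
exists U, V; split=> //.
- apply: partial_homeo_comp; [| |by exists (pi @^-1` U1), (pi @^-1` V1)
                                 |by exists (pi @^-1` U2), (pi @^-1` V2)].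
  + apply/seteqP; split=> y.
      move=> [z /pcompP[y' by_ ay]]; exists (pi y'); first exact: bE.
      by have : pdom a y'; [exists z|rewrite ad].
    move=> [c uy Uc]; have [y' by_] : pdom b y.
      by rewrite bd /preimage /= -ud; exists c.
    have [z az] : pdom a y'.
      by rewrite ad /preimage /=; move: uy; rewrite (bE _ _ by_) => -[->].
    by exists z; apply/pcompP; exists y'.
  + apply/seteqP; split=> z.
      move=> [y /pcompP[y' by_ ay]]; exists (pi y'); first exact/tt'/aE.
      by have : prange b y'; [exists y|rewrite br].
    move=> [c /tt' tc_ Vc]; have [y' ay] : prange a z.
      by rewrite ar /preimage /= -tr; exists c.
    have e : pi y' = c by exact: tI (aE _ _ ay) tc_.
    have [y by_] : prange b y' by rewrite br /preimage /= e.
    by exists y; apply/pcompP; exists y'.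
- apply: partial_homeo_comp; [| |by exists U1, V1|by exists U2, V2].
  + apply/seteqP; split=> c.
      move=> [z /pcompP[c' uc_ tc_]]; exists c' => //.
      by have : pdom t c'; [exists z|rewrite td].
    move=> [c' uc_ Uc]; have [z tz] : pdom t c' by rewrite td.
    by exists z; apply/pcompP; exists c'.
  + apply/seteqP; split=> z.
      move=> [c /pcompP[c' uc_ tc_]]; exists c'; first exact/tt'.
      by have : prange u c'; [exists c|rewrite ur].
    move=> [c' /tt' tc_ Vc]; have [c uc_] : prange u c' by rewrite ur.
    by exists c; apply/pcompP; exists c'.
- move=> y [c uy Uc]; have [y' by_] : pdom b y.
    by rewrite bd /preimage /= -ud; exists c.
  move: uy; rewrite /pcomp (bE _ _ by_) by_ => -[e] /=.
  by apply: at_; rewrite /preimage /= e.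
Qed.

(* componentwise composition, the right factor being applied first *)
Definition ppaut_mul (x y : ppaut) : ppaut :=
  PPAut (is_ppaut_comp (ppautP x) (ppautP y)).

Lemma ppaut_mulA : associative ppaut_mul.
Proof. by move=> x y z; apply: ppaut_eq => /=; rewrite pcompA. Qed.

HB.instance Definition _ := gen_eqMixin ppaut.
HB.instance Definition _ := gen_choiceMixin ppaut.
HB.instance Definition _ := isSemigroup.Build ppaut ppaut_mulA.

Lemma ppaut_inverse_semigroup (x : ppaut) :
  exists! y : ppaut, (x * y * x = x /\ y * x * y = y)%g.
Proof.
have inj (z : ppaut) : pinjective (ppaut_total z) /\ pinjective (ppaut_base z).
  by case: z => a t /= [U [V [_ _ /partial_homeo_inj ? /partial_homeo_inj ? _]]].
have [aI tI] := inj x.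
have ab := pinvP aI; have tu := pinvP tI.
exists (PPAut (is_ppaut_inv ab tu (ppautP x))); split.
  split; apply: ppaut_eq => /=.
  - exact: partial_inverseKK ab.
  - exact: partial_inverseKK tu.
  - exact: partial_inverseKK (partial_inverseC ab).
  - exact: partial_inverseKK (partial_inverseC tu).
move=> y [xyx yxy]; have [bI uI] := inj y.
apply: ppaut_eq => /=.
- by apply: pseudo_inverse_unique aI bI ab _ _;
    [rewrite -{3}xyx | rewrite -{3}yxy].
- by apply: pseudo_inverse_unique tI uI tu _ _;
    [rewrite -{3}xyx | rewrite -{3}yxy].
Qed.

HB.instance Definition _ := Semigroup_isInverse.Build ppaut ppaut_inverse_semigroup.

End Bundle.

(* A multiplicative map between inverse semigroups preserves inverses. *)
Definition inverse_semigroup_iso (S T : inverseSemigroupType) : Prop :=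
  exists phi : {multiplicative S -> T}, bijective phi.

(* Main.v *)
(** A partial automorphism (t, h) acts on opens by W |-> h(W) and on sections by
    s |-> t s h^-1.  Conversely an isomorphism of principal ideals of opens
    preserves unions, so the opens that contain the image of some neighbourhood
    of b form a completely prime filter; by soberness this is the neighbourhood
    filter of a point, taken to be h(b).  A point x of X is the germ of a section
    s at pi x, the image section of s has a germ at h(pi x), and the latter does
    not depend on s because two sections through x agree near pi x; this gives t.
    Both passages satisfy the same membership conditions
      W b <-> W' (h b)   and   s (pi x) = x <-> s' (pi (t x)) = t x,
    and these determine each of the two data from the other.  The conditions are
    symmetric under inversion, so injectivity of each construction is
    functionality of its mirror image. *)

From HB Require Import structures.
From mathcomp Require Import all_boot all_order all_classical topology.
Require Import Defs.

Set Implicit Arguments.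
Unset Strict Implicit.
Unset Printing Implicit Defensive.

Import Order.LTheory.

Local Open Scope classical_set_scope.

(** * Partial maps given by functional relations, and their inverses *)

Section PartialGraph.
Context {A B : Type}.
Implicit Types (R : A -> B -> Prop) (f : A -> option B).

(** Choice picks some value related to [x]; it is the only candidate once [R] is functional, as
    [pgraphP] assumes. *)
Definition pgraph R : A -> option B := fun x =>
  if pselect (exists y, R x y) is left h then Some (projT1 (cid h)) else None.

Lemma pgraphP R : (forall x y y', R x y -> R x y' -> y = y') ->
  forall x y, pgraph R x = Some y <-> R x y.
Proof.
move=> RI x y; rewrite /pgraph; case: pselect => [h|nh]; last first.
  by split=> // Rxy; case: nh; exists y.
by case: (cid h) => y' /= Rxy'; split=> [[<-]//|/(RI _ _ _ Rxy') <-].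
Qed.

End PartialGraph.

Lemma pgraph_inverse A B (R : A -> B -> Prop) (R' : B -> A -> Prop) :
  (forall x y, R x y <-> R' y x) ->
  (forall x y y', R x y -> R x y' -> y = y') ->
  (forall y x x', R' y x -> R' y x' -> x = x') ->
  partial_inverse (pgraph R) (pgraph R').
Proof. by move=> RR' RI R'I x y; rewrite pgraphP// pgraphP. Qed.

Lemma prange_pcomp A (f g f' g' : A -> option A) :
  partial_inverse f f' -> partial_inverse g g' ->
  prange (pcomp f g) = pdom (pcomp g' f').
Proof.
by move=> ff' gg'; rewrite (partial_inverse_dom (pcomp_partial_inverse ff' gg')).
Qed.

(** * One-directional forms of the two kinds of partial automorphisms *)

Section Munn.
Context {d} {E : meetSemilatticeType d} (Y : presheaf E).

(** Domains and monotonicity only. Ranges and order reflection are these same conditions for the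
    inverse pair, so each later fact is proved for one direction and used for both. *)
Definition half_munn (e : E) (a : Y -> option Y) (u : E -> option E) :=
  [/\ pdom a = presheaf_below e, pdom u = principal_ideal e,
      forall x y x' y', a x = Some x' -> a y = Some y' ->
        presheaf_le x y -> presheaf_le x' y',
      forall g k g' k', u g = Some g' -> u k = Some k' ->
        (g <= k)%O -> (g' <= k')%O &
      forall y y', a y = Some y' -> u (psupp y) = Some (psupp y')].

Lemma is_munnP a u a' u' : partial_inverse a a' -> partial_inverse u u' ->
  is_munn a u <-> exists e f, half_munn e a u /\ half_munn f a' u'.
Proof.
move=> aa' uu'; split=> [|[e [f [[ad ud ale ule supp] [ad' ud' ale' ule' _]]]]].
  have half b v : is_munn b v -> exists e, half_munn e b v.
    move=> [e [f [[bd _ _ ble] [vd _ _ vle] supp]]]; exists e; split=> //.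
    - by move=> x y x' y' bx by_; rewrite (ble _ _ _ _ bx by_).
    - by move=> x y x' y' bx by_; rewrite (vle _ _ _ _ bx by_).
    - by move=> y y' by_; rewrite -supp ?by_// -bd; exists y'.
  move=> au; have [e eau] := half _ _ au.
  by have [f fau] := half _ _ (is_munn_inv aa' uu' au); exists e, f.
exists e, f; split.
- split=> //; [by rewrite -(partial_inverse_dom aa')|exact: partial_inverse_inj aa'|].
  move=> x y x' y' ax ay; split; first exact: ale ax ay.
  by apply: ale'; apply/aa'.
- split=> //; [by rewrite -(partial_inverse_dom uu')|exact: partial_inverse_inj uu'|].
  move=> x y x' y' ax ay; split; first exact: ule ax ay.
  by apply: ule'; apply/uu'.
- move=> y; rewrite -ad => -[y' ay]; rewrite ay; symmetry; exact: supp.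
Qed.

End Munn.

Section PPAut.
Context {X B : topologicalType} (pi : X -> B).

(** The analogue of [half_munn]: [pdom h] takes the place of [U], and [V] is the domain of the
    inverse of [h]. *)
Definition half_ppaut (t : X -> option X) (h : B -> option B) :=
  [/\ open (pdom h), pcontinuous t, pcontinuous h,
      pdom t = pi @^-1` pdom h &
      forall x y, t x = Some y -> h (pi x) = Some (pi y)].

Lemma is_ppautP t h t' h' : partial_inverse t t' -> partial_inverse h h' ->
  is_ppaut pi t h <-> half_ppaut t h /\ half_ppaut t' h'.
Proof.
move=> tt' hh'; split=> [|[[hd tc hc td th] [hd' tc' hc' td' _]]].
  have half b v : is_ppaut pi b v -> half_ppaut b v.
    move=> [U [V [oU oV [bd _ bc _] [vd _ vc _] comm]]].
    split=> //; first by rewrite vd.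
      by rewrite bd vd.
    by move=> y y' by_; rewrite -comm ?by_// -bd; exists y'.
  by move=> au; split; apply: half => //; exact: is_ppaut_inv tt' hh' au.
exists (pdom h), (pdom h'); split=> //.
- by split=> //; [rewrite -td' (partial_inverse_dom tt')|exists t'].
- by split=> //; [rewrite (partial_inverse_dom hh')|exists h'].
- move=> x; rewrite -td => -[y tx]; rewrite tx; symmetry; exact: th.
Qed.

End PPAut.

(** * Openness criteria and local sections of a local homeomorphism *)

Section PartialTopology.
Context {S T : topologicalType}.

Lemma pcontinuous_openI (f : S -> option T) :
  (forall O, open O -> open [set x | exists2 y, f x = Some y & O y]) ->
  pcontinuous f.
Proof.
move=> fo; apply/pcontinuousP => O /fo oO; eexists; first exact: oO.
by apply/seteqP; split=> [x [y fx Oy]|x []//]; split=> //; [exists y|exists y].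
Qed.

Lemma open_locally (A : set S) :
  (forall x, A x -> exists N : set S, [/\ open N, N x & N `<=` A]) -> open A.
Proof.
move=> loc; rewrite openE => x /loc[N [oN Nx NA]].
by rewrite /interior; apply: filterS NA _; exact: open_nbhs_nbhs.
Qed.

End PartialTopology.

Section Sections.
Context {X B : topologicalType} (pi : X -> B).
Implicit Types (s r : local_section pi) (W : opens B).

Lemma section_leP s r : @presheaf_le _ _ (section_presheaf pi) s r <->
  forall b x, s b = Some x -> r b = Some x.
Proof.
split=> [-> b x /prestrictP[]//|sr]; apply: local_section_eq; apply: peq => b x.
split=> [sb|/prestrictP[[x' sb] rb]].
  by apply/prestrictP; split; [exists x|exact: sr].
by move: (sb) => /sr; rewrite rb => -[->].
Qed.

Context (pi_local : local_homeomorphism pi).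

(** The inverse of [pi] on a neighbourhood of [x] is a section through [x]; restricting it to [W]
    bounds its domain. *)
Lemma section_through x W : (W : set B) (pi x) ->
  exists2 s : local_section pi, s (pi x) = Some x & (section_dom s <= W)%O.
Proof.
move=> Wx; have [N [oN Nx opiN [_ _ _ [g pg gc]]]] := pi_local x.
have gE b y : g b = Some y <-> N y /\ pi y = b.
  rewrite -pg prestrictP /=; split=> -[Ny]; first by case.
  by move=> <-.
have go : open (pdom g).
  suff -> : pdom g = pi @` N by [].
  by apply/seteqP; split=> [b [y /gE[]]|b [y Ny yb]]; exists y => //; apply/gE.
have gid b y : g b = Some y -> pi y = b by move=> /gE[].
exists (section_restrict (LocalSection go gc gid) W).
  by apply/prestrictP; split=> //; apply/gE.
by rewrite opens_le => b [y /prestrictP[]].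
Qed.

(** This set is the image of [s]. If [pi] is injective on [N], and both [y] and [s (pi y)] lie in
    [N], they coincide, since both lie over [pi y]; such [y] form an open set. *)
Lemma section_image_open s : open [set x | s (pi x) = Some x].
Proof.
apply: open_locally => x sx; have [N [oN Nx _ [Nd _ Nc [g pg _]]]] := pi_local x.
have NI := partial_inverse_inj pg.
exists [set y | exists2 b, prestrict N (Some \o pi) y = Some b &
                 exists2 z, s b = Some z & N z]; split.
- apply: pcontinuous_open => //; first by rewrite Nd.
  by apply: pcontinuous_open => //; [exact: section_continuous|exact: section_open].
- by exists (pi x); [apply/prestrictP|exists x].
- move=> y [b /prestrictP[Ny /= [<-]] [z sz Nz]]; rewrite /= sz; congr Some.
  apply: (NI _ _ (pi y)); apply/prestrictP; split=> //=.
  by rewrite (section_id sz).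
Qed.

(** The two sections agree wherever [r] takes values in the image of [s], and that image is open. *)
Lemma section_agree s r b x : s b = Some x -> r b = Some x ->
  exists2 q : local_section pi, q b = Some x &
    @presheaf_le _ _ (section_presheaf pi) q s /\
    @presheaf_le _ _ (section_presheaf pi) q r.
Proof.
move=> sb rb.
pose W := [set c | exists2 y, r c = Some y & s (pi y) = Some y].
have oW : open W.
  apply: pcontinuous_open (section_image_open s) => //.
    exact: section_continuous.
  exact: section_open.
exists (section_restrict s (mk_opens oW)).
  apply/prestrictP; split=> //; exists x => //.
  by rewrite (section_id sb).
split; apply/section_leP => c y /prestrictP[Wc sc] //.
by move: Wc => [z rc]; rewrite (section_id rc) sc => -[->].
Qed.

End Sections.

(** * The correspondence between the two kinds of partial automorphisms, and its compatibility with
    composition *)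

Section Correspondence.
Context {X B : topologicalType} (pi : X -> B).
Local Notation Sec := (section_presheaf pi).
Implicit Types (a : Sec -> option Sec) (u : opens B -> option (opens B))
  (t : X -> option X) (h : B -> option B) (W V : opens B) (s r : Sec).

Definition open_compat u h := forall W W' b c,
  u W = Some W' -> h b = Some c -> ((W : set B) b <-> (W' : set B) c).

(** [s (pi x) = Some x] says that [x] lies in the image of [s], so images of sections are compared
    here as opens are in [open_compat]. *)
Definition section_compat a t := forall s s' x y,
  a s = Some s' -> t x = Some y ->
  ((s : local_section pi) (pi x) = Some x <->
   (s' : local_section pi) (pi y) = Some y).

(** Empty maps satisfy both compatibilities vacuously; the first two clauses tie the domains and
    ranges together. *)
Definition corresponds a u t h :=
  [/\ forall W, pdom u W <-> (W : set B) `<=` pdom h,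
      forall W, prange u W <-> (W : set B) `<=` prange h,
      open_compat u h & section_compat a t].

(** The open [u2 W] lies in the range of [h2], so by compatibility its points are exactly the [h2 b]
    with [b] in [W]. It therefore lies in [pdom h1] exactly when [h1] is defined at all these
    points. *)
Lemma corresponds_comp_dom u1 h1 u2 h2 :
  (forall W, pdom u1 W <-> (W : set B) `<=` pdom h1) ->
  (forall W, pdom u2 W <-> (W : set B) `<=` pdom h2) ->
  (forall W, prange u2 W <-> (W : set B) `<=` prange h2) ->
  open_compat u2 h2 ->
  forall W, pdom (pcomp u1 u2) W <-> (W : set B) `<=` pdom (pcomp h1 h2).
Proof.
move=> d1 d2 r2 oc W; split.
  move=> [W1 /pcompP[W' uW uW']] b Wb.
  have [c hb] : pdom h2 b by apply: (iffLR (d2 W)) => //; exists W'.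
  have [z hc] : pdom h1 c.
    by apply: (iffLR (d1 W')); [exists W1|apply/(oc _ _ _ _ uW hb)].
  by exists z; apply/pcompP; exists c.
move=> Wh; have [W' uW] : pdom u2 W.
  by apply/d2 => b /Wh[z /pcompP[c hb _]]; exists c.
have [W1 uW'] : pdom u1 W'.
  apply/d1 => c W'c; have [b hb] : prange h2 c.
    by apply: (iffLR (r2 W')) => //; exists W.
  have /Wh[z /pcompP[c' ]] : (W : set B) b by apply/(oc _ _ _ _ uW hb).
  by rewrite hb => -[<-] hc; exists z.
by exists W1; apply/pcompP; exists W'.
Qed.

Lemma corresponds_comp a1 u1 t1 h1 a2 u2 t2 h2 :
  pinjective u1 -> pinjective h1 -> pinjective u2 -> pinjective h2 ->
  corresponds a1 u1 t1 h1 -> corresponds a2 u2 t2 h2 ->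
  corresponds (pcomp a1 a2) (pcomp u1 u2) (pcomp t1 t2) (pcomp h1 h2).
Proof.
move=> /pinvP uu1 /pinvP hh1 /pinvP uu2 /pinvP hh2 [d1 r1 o1 s1] [d2 r2 o2 s2].
split.
- exact: corresponds_comp_dom.
(* Ranges of composites are domains of the composites of the inverses, so the domain lemma applies
   again. *)
- move=> W; rewrite (prange_pcomp uu1 uu2) (prange_pcomp hh1 hh2).
  apply: corresponds_comp_dom => [V|V|V|V V' b c].
  + by rewrite (partial_inverse_dom uu2) (partial_inverse_dom hh2).
  + by rewrite (partial_inverse_dom uu1) (partial_inverse_dom hh1).
  + by rewrite (partial_inverse_range uu1) (partial_inverse_range hh1).
  + by move=> /uu1 uV /hh1 hb; symmetry; apply: o1.
- move=> W W1 b d /pcompP[W' uW uW'] /pcompP[c hb hc].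
  by rewrite (o2 _ _ _ _ uW hb); apply: o1.
- move=> s s1' x z /pcompP[s' as_ as'] /pcompP[y tx ty].
  by rewrite (s2 _ _ _ _ as_ tx); apply: s1.
Qed.

End Correspondence.

(** * From a partial automorphism of the bundle to a Munn element *)

Section FromPPAut.
Context {X B : topologicalType} (pi : X -> B).
Local Notation Sec := (section_presheaf pi).

(** [open_rel] encodes W' = h(W), and [section_rel] encodes s' = t s h^-1. Membership conditions
    replace image formulas so that inversion merely swaps the two arguments. *)
Definition open_rel (h : B -> option B) (W W' : opens B) :=
  [/\ (W : set B) `<=` pdom h, (W' : set B) `<=` prange h &
      forall b c, h b = Some c -> ((W : set B) b <-> (W' : set B) c)].

Definition section_rel (t : X -> option X) (h : B -> option B) (s s' : Sec) :=
  [/\ (section_dom s : set B) `<=` pdom h, (section_dom s' : set B) `<=` prange h &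
      forall x y, t x = Some y ->
        ((s : local_section pi) (pi x) = Some x <->
         (s' : local_section pi) (pi y) = Some y)].

Lemma open_rel_inv h h' W W' : partial_inverse h h' ->
  open_rel h W W' <-> open_rel h' W' W.
Proof.
suff half g g' V V' : partial_inverse g g' -> open_rel g V V' -> open_rel g' V' V.
  by move=> hh'; split; apply: half => //; exact: partial_inverseC.
move=> gg' [Vd Vr VV']; split.
- by rewrite (partial_inverse_dom gg').
- by rewrite (partial_inverse_range gg').
- by move=> b c /gg' /VV' ->.
Qed.

Lemma section_rel_inv t t' h h' s s' : partial_inverse t t' ->
  partial_inverse h h' -> section_rel t h s s' <-> section_rel t' h' s' s.
Proof.
suff half p p' g g' r r' : partial_inverse p p' -> partial_inverse g g' ->
    section_rel p g r r' -> section_rel p' g' r' r.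
  by move=> tt' hh'; split; apply: half => //; exact: partial_inverseC.
move=> pp' gg' [Vd Vr VV']; split.
- by rewrite (partial_inverse_dom gg').
- by rewrite (partial_inverse_range gg').
- by move=> b c /pp' /VV' ->.
Qed.

(** Points of [W'] lift along [h] because [W'] lies in its range. The case [V = W] gives
    functionality by antisymmetry. *)
Lemma open_rel_le h W V W' V' : open_rel h W W' -> open_rel h V V' ->
  (W <= V)%O -> (W' <= V')%O.
Proof.
rewrite !opens_le => -[_ W'r WW'] [_ _ VV'] WV c W'c.
by have [b hb] := W'r _ W'c; apply/(VV' _ _ hb)/WV/(WW' _ _ hb).
Qed.

Lemma open_rel_fun h W W' V' : open_rel h W W' -> open_rel h W V' -> W' = V'.
Proof.
move=> WW' WV'; apply: le_anti.
by rewrite (open_rel_le WW' WV')// (open_rel_le WV' WW').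
Qed.

Section OneDirection.
Context (t t' : X -> option X) (h h' : B -> option B).
Context (tt' : partial_inverse t t') (hh' : partial_inverse h h').
Context (th : half_ppaut pi t h) (th' : half_ppaut pi t' h').

(** A value [y] of [s'] lies over the range of [h], and [t'] is defined on whole fibres there. So
    [y] is the image of some [x] under [t], and membership passes from [s'] to [s], [r] and [r']. *)
Lemma section_rel_le s r s' r' : section_rel t h s s' -> section_rel t h r r' ->
  presheaf_le s r -> presheaf_le s' r'.
Proof.
move=> [_ s'r ss'] [_ _ rr'] /section_leP sr; apply/section_leP => c y s'c.
have yc : pi y = c := section_id s'c.
have [x /tt' tx] : pdom t' y.
  have [_ _ _ -> _] := th'; rewrite /preimage /= yc (partial_inverse_dom hh').
  by apply: s'r; exists y.
by rewrite -yc; apply/(rr' _ _ tx)/sr/(ss' _ _ tx); rewrite yc.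
Qed.

Lemma section_rel_fun s s' r' : section_rel t h s s' -> section_rel t h s r' ->
  s' = r'.
Proof.
have refl : presheaf_le s s by apply/section_leP.
move=> ss' sr'; apply: local_section_eq; apply: peq => b x.
have /section_leP le1 := section_rel_le ss' sr' refl.
have /section_leP le2 := section_rel_le sr' ss' refl.
by split=> [/le1|/le2].
Qed.

Lemma open_rel_total (W : opens B) : (W : set B) `<=` pdom h ->
  exists W', open_rel h W W'.
Proof.
move=> Wh; have [h'o _ h'c _ _] := th'.
exists (mk_opens (pcontinuous_open h'c h'o (opens_open W))); split=> //.
  by move=> c [b /hh' hb _]; exists b.
move=> b c hb /=; split=> [Wb|[b' /hh' hb' Wb']].
  by exists b => //; apply/hh'.
by rewrite (partial_inverse_inj hh' hb hb').
Qed.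

Lemma section_rel_total (s : Sec) : (section_dom s : set B) `<=` pdom h ->
  exists s', section_rel t h s s'.
Proof.
move=> sh; have [ho tc _ td tpi] := th; have [h'o _ h'c _ _] := th'.
pose s0 := pcomp t (pcomp (section_map s) h').
have s0P c y : s0 c = Some y <->
    exists b x, [/\ h b = Some c, section_map s b = Some x & t x = Some y].
  split=> [/pcompP[x /pcompP[b /hh' hb sb] tx]|[b [x [/hh' hb sb tx]]]].
    by exists b, x.
  by apply/pcompP; exists x => //; apply/pcompP; exists b.
have s0o : open (pdom s0).
  (* Applying [t] does not shrink the domain: it is defined on all fibres over [pdom h], which
     contains the domain of [s]. *)
  have -> : pdom s0 = [set c | exists2 b, h' c = Some b & pdom (section_map s) b].
    apply/seteqP; split=> [c [y /s0P[b [x [/hh' hb sb tx]]]]|c [b /hh' hb [x sb]]].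
      by exists b => //; exists x.
    have [y tx] : pdom t x.
      by rewrite td /preimage /= (section_id sb); apply: sh; exists x.
    by exists y; apply/s0P; exists b, x.
  exact: pcontinuous_open h'c h'o (section_open s).
have s0c : pcontinuous s0.
  apply: pcontinuous_comp => //; apply: pcontinuous_comp => //.
  exact: section_continuous.
have s0id c y : s0 c = Some y -> pi y = c.
  move=> /s0P[b [x [hb sb /tpi]]].
  by rewrite (section_id sb) hb => -[].
exists (LocalSection s0o s0c s0id); split=> //.
  by move=> c [y /s0P[b [x [hb _ _]]]]; exists b.
move=> x y tx; split=> [sx|/s0P[b [x' [hb sb tx']]]].
  by apply/s0P; exists (pi x), x; split=> //; exact: tpi.
by rewrite (partial_inverse_inj hh' (tpi _ _ tx) hb) sb
           (partial_inverse_inj tt' tx tx').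
Qed.

(** This supplies the condition linking the two components of a Munn element: [t] carries the point
    of [s] over [b] to a point of [s'] over [h b], and [t'] goes back. *)
Lemma section_rel_dom (s s' : Sec) :
  section_rel t h s s' -> open_rel h (section_dom s) (section_dom s').
Proof.
move=> [sh s'h ss']; split=> // b c hb; split=> [[x sb]|[y sc]].
  have xb := section_id sb; have [_ _ _ td tpi] := th.
  have [y tx] : pdom t x by rewrite td /preimage /= xb; exists c.
  have -> : c = pi y by have := tpi _ _ tx; rewrite xb hb => -[].
  by exists y; apply/(ss' _ _ tx); rewrite xb.
have yc := section_id sc; have [_ _ _ td' t'pi] := th'.
have [x tx] : pdom t' y by rewrite td' /preimage /= yc; exists b; apply/hh'.
have -> : b = pi x.
  by have := t'pi _ _ tx; rewrite yc (iffLR (hh' b c) hb) => -[].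
by exists x; apply/(ss' x y); [apply/tt'|rewrite yc].
Qed.

Lemma section_relP s s' : pgraph (section_rel t h) s = Some s' <-> section_rel t h s s'.
Proof. by apply: pgraphP => *; apply: section_rel_fun; eassumption. Qed.

Lemma open_relP W W' : pgraph (open_rel h) W = Some W' <-> open_rel h W W'.
Proof. by apply: pgraphP => *; apply: open_rel_fun; eassumption. Qed.

Lemma half_munn_rel :
  exists e, half_munn e (pgraph (section_rel t h)) (pgraph (open_rel h)).
Proof.
have [ho _ _ _ _] := th; exists (mk_opens ho); split.
- apply/seteqP; split=> [s [s' /section_relP[sh _ _]]|s].
    by rewrite /presheaf_below /= opens_le.
  rewrite /presheaf_below /= opens_le => /section_rel_total[s' ss'].
  by exists s'; apply/section_relP.
- apply/seteqP; split=> [W [W' /open_relP[Wh _ _]]|W].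
    by rewrite /principal_ideal /= opens_le.
  rewrite /principal_ideal /= opens_le => /open_rel_total[W' WW'].
  by exists W'; apply/open_relP.
- by move=> s r s' r' /section_relP ss' /section_relP; exact: section_rel_le.
- by move=> W V W' V' /open_relP WW' /open_relP; exact: open_rel_le.
- by move=> s s' /section_relP /section_rel_dom /open_relP.
Qed.

End OneDirection.

Lemma munn_of_ppaut (x : ppaut pi) : exists m : munn Sec,
  corresponds (munn_sections m) (munn_index m) (ppaut_total x) (ppaut_base x).
Proof.
case: x => t h /= ph.
have [U [V [_ _ /partial_homeo_inj tI /partial_homeo_inj hI _]]] := ph.
have tt' := pinvP tI; have hh' := pinvP hI.
have tt := partial_inverseC tt'; have hh := partial_inverseC hh'.
have [th th'] := iffLR (is_ppautP pi tt' hh') ph.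
set t' := pinv t in tt' tt th'; set h' := pinv h in hh' hh th'.
have aa' : partial_inverse (pgraph (section_rel t h)) (pgraph (section_rel t' h')).
  apply: pgraph_inverse => [s s'||].
  - exact: section_rel_inv.
  - exact: section_rel_fun.
  - exact: section_rel_fun.
have uu' : partial_inverse (pgraph (open_rel h)) (pgraph (open_rel h')).
  apply: pgraph_inverse => [s s'||].
  - exact: open_rel_inv.
  - exact: open_rel_fun.
  - exact: open_rel_fun.
have au : is_munn (pgraph (section_rel t h)) (pgraph (open_rel h)).
  apply/(is_munnP aa' uu').
  have [e he] := half_munn_rel tt' hh' th th'.
  by have [f hf] := half_munn_rel tt hh th' th; exists e, f.
exists (Munn au); split=> /=.
- move=> W; split=> [[W' /open_relP[]//]|/(open_rel_total hh' th')[W' WW']].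
  by exists W'; apply/open_relP.
- move=> W; rewrite -(partial_inverse_dom uu') -(partial_inverse_dom hh').
  split=> [[W' /open_relP[]//]|/(open_rel_total hh th)[W' WW']].
  by exists W'; apply/open_relP.
- by move=> W W' b c /open_relP[_ _]; apply.
- by move=> s s' x y /(section_relP tt' hh' th')[_ _]; apply.
Qed.

End FromPPAut.

(** * From a Munn element to a partial automorphism of the bundle, by soberness and germs *)

Section FromMunn.
Context {X B : topologicalType} (pi : X -> B).
Local Notation Sec := (section_presheaf pi).
Implicit Types (a : Sec -> option Sec) (u : opens B -> option (opens B)).

Lemma nbhs_filter_completely_prime (b : B) : completely_prime_filter (nbhs_filter b).
Proof.
split=> [|U V|U V|C W WE].
- by exists (mk_opens openT).
- by rewrite opens_le => UV /UV.
- by rewrite /nbhs_filter /= opens_meet.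
- by rewrite /nbhs_filter /= WE => -[U CU Ub]; exists U.
Qed.

(** Both points have the same neighbourhood filter, which is completely prime and so comes from a
    unique point. *)
Lemma sober_kolmogorov (b c : B) : sober B ->
  (forall U : opens B, (U : set B) b <-> (U : set B) c) -> b = c.
Proof.
move=> sB bc; have [z [_ zI]] := sB _ (nbhs_filter_completely_prime b).
rewrite -(zI b)//; apply: zI; apply/seteqP.
by split=> U; rewrite /nbhs_filter /= bc.
Qed.

(** The graph of the base map to be built; [e] and [f] are its intended domain and range. *)
Definition point_rel (e f : opens B) u (b c : B) :=
  [/\ (e : set B) b, (f : set B) c &
      forall W W', u W = Some W' -> ((W : set B) b <-> (W' : set B) c)].

Definition germ_rel (e f : opens B) a u (x y : X) :=
  point_rel e f u (pi x) (pi y) /\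
  forall s s' : Sec, a s = Some s' ->
    ((s : local_section pi) (pi x) = Some x <->
     (s' : local_section pi) (pi y) = Some y).

Lemma point_rel_inv e f u u' b c : partial_inverse u u' ->
  point_rel e f u b c <-> point_rel f e u' c b.
Proof.
suff half e1 f1 v v' b1 c1 : partial_inverse v v' ->
    point_rel e1 f1 v b1 c1 -> point_rel f1 e1 v' c1 b1.
  by move=> uu'; split; apply: half => //; exact: partial_inverseC.
by move=> vv' [eb fc vbc]; split=> // W W' /vv' /vbc ->.
Qed.

Lemma germ_rel_inv e f a u a' u' x y :
  partial_inverse a a' -> partial_inverse u u' ->
  germ_rel e f a u x y <-> germ_rel f e a' u' y x.
Proof.
move=> aa' uu'; rewrite /germ_rel (point_rel_inv e f _ _ uu').
by split=> -[pq sc]; split=> // s s' /aa' /sc ->.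
Qed.

Section OneDirection.
Context (pi_etale : etale_bundle pi) (soberB : sober B).
Context (a a' : Sec -> option Sec) (u u' : opens B -> option (opens B)).
Context (aa' : partial_inverse a a') (uu' : partial_inverse u u').
Context (e f : opens B) (au : half_munn e a u) (au' : half_munn f a' u').

Lemma munn_domP W : pdom u W <-> (W <= e)%O.
Proof. by have [_ -> _ _ _] := au. Qed.

Lemma munn_rangeP W : (exists V, u V = Some W) <-> (W <= f)%O.
Proof.
have [_ ud' _ _ _] := au'; have := partial_inverse_dom uu'; rewrite ud' => fE.
by have -> : (W <= f)%O = principal_ideal f W :> Prop; [|rewrite fE].
Qed.

Lemma munn_le W V W' V' : u W = Some W' -> u V = Some V' ->
  (W <= V)%O <-> (W' <= V')%O.
Proof.
move=> uW uV; have [_ _ _ ule _] := au; have [_ _ _ ule' _] := au'.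
by split; [apply: ule|apply: ule'; apply/uu'].
Qed.

(** Each open [V] cut down to [f] is some [u W], and whether [b] lies in [W] decides membership of
    both [c] and [c'] in [V]. *)
Lemma point_rel_fun b c c' : point_rel e f u b c -> point_rel e f u b c' -> c = c'.
Proof.
move=> [_ fc bc] [_ fc' bc']; apply: sober_kolmogorov => // V.
have [W uW] : exists W, u W = Some (V `&` f)%O by apply/munn_rangeP; exact: leIr.
have := bc _ _ uW; have := bc' _ _ uW; rewrite opens_meet.
by move=> [l1 r1] [l2 r2]; split=> Vc;
  [have /r2/l1[] : (V `&` f) c|have /r1/l2[] : (V `&` f) c'].
Qed.

(* The opens containing the image of some domain neighbourhood of [b] form a
   completely prime filter; soberness supplies the image point. *)
Lemma point_rel_total (b : B) : (e : set B) b -> exists c, point_rel e f u b c.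
Proof.
move=> eb.
pose F := [set V : opens B |
  exists W W' : opens B, [/\ u W = Some W', (W : set B) b & (W' <= V)%O]].
have [e' ue] : pdom u e by apply/munn_domP.
have cpF : completely_prime_filter F.
  split=> [|U V UV [W [W' [uW Wb W'U]]]||C V VE [W [W' [uW Wb W'V]]]].
  - by exists e', e, e'.
  - by exists W, W'; split=> //; exact: le_trans UV.
  - move=> U V [W1 [W1' [uW1 W1b W1U]]] [W2 [W2' [uW2 W2b W2V]]].
    have W1e : (W1 <= e)%O by apply/munn_domP; exists W1'.
    have [W' uW] : pdom u (W1 `&` W2)%O.
      by apply/munn_domP; apply: le_trans W1e; exact: leIl.
    exists (W1 `&` W2)%O, W'; split=> //.
    rewrite lexI; apply/andP; split.
      by apply: le_trans W1U; apply/(munn_le uW uW1); exact: leIl.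
    by apply: le_trans W2V; apply/(munn_le uW uW2); exact: leIr.
  (* The preimages under [u] of the traces on [W'] of the cover of [V]. The image of their union [Z]
     contains every trace, hence [W']; reflecting the order, [W] lies in [Z], and so [b] lies in a
     single member of [D]. *)
  - pose D := [set G : opens B | exists2 U, C U & u G = Some (U `&` W')%O].
    have W'f : (W' <= f)%O by apply/munn_rangeP; exists W.
    have oZ : open (\bigcup_(G in D) (G : set B)).
      by apply: bigcup_open => G _; exact: opens_open.
    pose Z := mk_opens oZ.
    have [Z' uZ] : pdom u Z.
      apply/munn_domP; rewrite opens_le => z [G [U _ uG] Gz].
      have : (G <= e)%O by apply/munn_domP; eexists; exact: uG.
      by rewrite opens_le; apply.
    have W'Z' : (W' <= Z')%O.
      rewrite opens_le => z W'z; have : (V : set B) z.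
        by move: W'V; rewrite opens_le; apply.
      rewrite VE => -[U CU Uz].
      have [G uG] : exists G, u G = Some (U `&` W')%O.
        by apply/munn_rangeP; apply: le_trans W'f; exact: leIr.
      have : (U `&` W' <= Z')%O.
        apply/(munn_le uG uZ); rewrite opens_le => y Gy.
        by exists G => //; exists U.
      by rewrite opens_le; apply; rewrite opens_meet.
    have : (Z : set B) b.
      have : (W <= Z)%O by apply/(munn_le uW uZ).
      by rewrite opens_le; apply.
    move=> [G [U CU uG] Gb]; exists U => //; exists G, (U `&` W')%O.
    by split=> //; exact: leIl.
have [c [Fc _]] := soberB cpF.
have FE (V : opens B) : F V <-> (V : set B) c by rewrite Fc.
exists c; split=> //.
  apply/FE; exists e, e'; split=> //.
  by apply/munn_rangeP; exists e.
(* In the converse, [G] is a neighbourhood of [b] whose image lies in [W'], so order reflection puts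
   [G] inside [W]. *)
move=> W W' uW; split=> [Wb|/FE[G [G' [uG Gb G'W']]]].
  by apply/FE; exists W, W'.
by have := iffRL (munn_le uG uW) G'W'; rewrite opens_le; apply.
Qed.

Lemma section_in_dom (s : Sec) : (section_dom s <= e)%O -> exists s', a s = Some s'.
Proof.
have [ad _ _ _ _] := au => se.
by have : pdom a s by rewrite ad.
Qed.

Lemma point_rel_section b c (s s' : Sec) : point_rel e f u b c ->
  a s = Some s' -> pdom (section_map s) b <-> pdom (section_map s') c.
Proof.
by move=> [_ _ bc] as_; have [_ _ _ _ supp] := au; exact: bc (supp _ _ as_).
Qed.

(** The sections [s] and [r] have a common restriction [q] through [x]. Its image is defined at [c]
    and, by monotonicity, lies below both [s'] and [r']. *)
Lemma germ_transport b c (s s' r r' : Sec) x y : point_rel e f u b c ->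
  a s = Some s' -> a r = Some r' ->
  section_map s b = Some x -> section_map r b = Some x ->
  section_map s' c = Some y -> section_map r' c = Some y.
Proof.
move=> bc as_ ar sb rb s'c; have [ad _ ale _ _] := au.
have [q qb [qs qr]] := section_agree pi_etale.2 sb rb.
have [q' aq] : exists q', a q = Some q'.
  apply: section_in_dom.
  have se : (section_dom s <= e)%O.
    by have : pdom a s; [exists s'|rewrite ad].
  apply: le_trans se; rewrite opens_le => z [w qz].
  by exists w; move/section_leP: qs; apply.
have [z q'c] : pdom (section_map q') c.
  by apply/(point_rel_section bc aq); exists x.
have /section_leP q's := ale _ _ _ _ aq as_ qs.
have /section_leP q'r := ale _ _ _ _ aq ar qr.
by rewrite (q'r _ _ q'c); have := q's _ _ q'c; rewrite s'c => -[->].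
Qed.

Lemma section_through_dom x : (e : set B) (pi x) ->
  exists s s' : Sec, section_map s (pi x) = Some x /\ a s = Some s'.
Proof.
move=> ex; have [s sx se] := section_through pi_etale.2 ex.
by have [s' as_] := section_in_dom se; exists s, s'.
Qed.

(** The base point [pi y] is already determined, and [y] is the value there of the image of any
    section through [x]. *)
Lemma germ_rel_fun x y y' : germ_rel e f a u x y -> germ_rel e f a u x y' -> y = y'.
Proof.
move=> [xy sy] [xy' sy']; have [ex _ _] := xy.
have [s [s' [sx as_]]] := section_through_dom ex.
have := iffLR (sy' _ _ as_) sx; rewrite -(point_rel_fun xy xy').
by rewrite (iffLR (sy _ _ as_) sx) => -[].
Qed.

End OneDirection.

Section TwoDirections.
Context (pi_etale : etale_bundle pi) (soberB : sober B).

Lemma germ_rel_total a a' u u' (e f : opens B) x :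
  partial_inverse a a' -> partial_inverse u u' ->
  half_munn e a u -> half_munn f a' u' -> (e : set B) (pi x) ->
  exists y, germ_rel e f a u x y.
Proof.
move=> aa' uu' au au' ex.
have [c bc] := point_rel_total soberB uu' au au' ex.
have [s [s' [sx as_]]] := section_through_dom pi_etale au ex.
have [y s'c] : pdom (section_map s') c.
  by apply/(point_rel_section au bc as_); exists x.
exists y; rewrite /germ_rel (section_id s'c); split=> // r r' ar.
split=> [rx|r'c]; first exact: (germ_transport pi_etale au bc as_ ar sx rx s'c).
(* The reverse implication is transport of germs along the inverse pair, from [y] back to [x]. *)
apply: (germ_transport pi_etale au' (iffLR (point_rel_inv e f _ _ uu') bc)
  (iffLR (aa' _ _) as_) (iffLR (aa' _ _) ar) s'c r'c sx).
Qed.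

Section Half.
Context a a' u u' (aa' : partial_inverse a a') (uu' : partial_inverse u u').
Context (e f : opens B) (au : half_munn e a u) (au' : half_munn f a' u').

Let h := pgraph (point_rel e f u).
Let t := pgraph (germ_rel e f a u).

Lemma point_relP b c : h b = Some c <-> point_rel e f u b c.
Proof. by apply: pgraphP => *; apply: point_rel_fun; eassumption. Qed.

Lemma germ_relP x y : t x = Some y <-> germ_rel e f a u x y.
Proof. by apply: pgraphP => *; apply: germ_rel_fun; eassumption. Qed.

Lemma pdom_point_rel : pdom h = (e : set B).
Proof.
apply/seteqP; split=> [b [c /point_relP[]]//|b eb].
by have [c bc] := point_rel_total soberB uu' au au' eb; exists c; apply/point_relP.
Qed.

Lemma half_ppaut_rel : half_ppaut pi t h.
Proof.
split.
- by rewrite pdom_point_rel; exact: opens_open.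
(* Take [s] through [x] with image [s'] through [y], and let [W] be the open that [u] sends to the
   set where [s'] takes values in [O]. The image of [s] over [W] is an open neighbourhood of [x],
   and [t] maps it into [O]. *)
- apply: pcontinuous_openI => O oO; apply: open_locally => x [y /germ_relP[xy sy] Oy].
  have [ex _ bc] := xy; have [s [s' [sx as_]]] := section_through_dom pi_etale au ex.
  have s'y := iffLR (sy _ _ as_) sx.
  have oV : open [set c | exists2 y, section_map s' c = Some y & O y].
    apply: pcontinuous_open => //; first exact: section_continuous.
    exact: section_open.
  have s'f : (section_dom s' <= f)%O.
    apply/(munn_rangeP uu' au'); exists (section_dom s).
    by have [_ _ _ _ supp] := au; exact: supp as_.
  have [W uW] : exists W, u W = Some (mk_opens oV).
    apply/(munn_rangeP uu' au'); apply: le_trans s'f.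
    by rewrite opens_le => c [z s'c _]; exists z.
  exists [set z | section_restrict s W (pi z) = Some z]; split.
  + exact: section_image_open pi_etale.2 (section_restrict s W).
  + by apply/prestrictP; split=> //; apply/(bc _ _ uW); exists y.
  + move=> z /prestrictP[Wz sz].
    have ez : (e : set B) (pi z).
      have : (W <= e)%O by apply/(munn_domP au); eexists; exact: uW.
      by rewrite opens_le; apply.
    have [w zw] := germ_rel_total aa' uu' au au' ez.
    exists w; first exact/germ_relP.
    have [[_ _ zwW] zws] := zw; have [w' s'w Ow'] := iffLR (zwW _ _ uW) Wz.
    by move: s'w; rewrite (iffLR (zws _ _ as_) sz) => -[->].
(* The preimage of [O] under [h] is the open that [u] sends to the part of [O] inside [f]. *)
- apply: pcontinuous_openI => O oO; pose V := mk_opens oO.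
  have [W uW] : exists W, u W = Some (V `&` f)%O.
    by apply/(munn_rangeP uu' au'); exact: leIr.
  suff -> : [set b | exists2 c, h b = Some c & O c] = (W : set B) by exact: opens_open.
  apply/seteqP; split=> [b [c /point_relP[eb fc bc] Oc]|b Wb].
    by apply/(bc _ _ uW); rewrite opens_meet.
  have eb : (e : set B) b.
    have : (W <= e)%O by apply/(munn_domP au); eexists; exact: uW.
    by rewrite opens_le; apply.
  have [c bc] := point_rel_total soberB uu' au au' eb.
  exists c; first exact/point_relP.
  have [_ _ /(_ _ _ uW)[/(_ Wb)]] := bc.
  by rewrite opens_meet => -[].
- rewrite pdom_point_rel; apply/seteqP; split=> [x [y /germ_relP[[]]]//|x ex].
  by have [y xy] := germ_rel_total aa' uu' au au' ex; exists y; apply/germ_relP.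
- by move=> x y /germ_relP[xy _]; apply/point_relP.
Qed.

Lemma pdom_munn_index W : pdom u W <-> (W : set B) `<=` pdom h.
Proof. by rewrite pdom_point_rel -opens_le; exact: munn_domP au W. Qed.

End Half.

Lemma ppaut_of_munn (m : munn Sec) : exists x : ppaut pi,
  corresponds (munn_sections m) (munn_index m) (ppaut_total x) (ppaut_base x).
Proof.
case: m => a u /= am.
have [e0 [f0 [[_ _ aI _] [_ _ uI _] _]]] := am.
have aa' := pinvP aI; have uu' := pinvP uI.
have a'a := partial_inverseC aa'; have u'u := partial_inverseC uu'.
have [e [f [au au']]] := iffLR (is_munnP aa' uu') am.
set a' := pinv a in aa' a'a au'; set u' := pinv u in uu' u'u au'.
have tt' : partial_inverse (pgraph (germ_rel e f a u)) (pgraph (germ_rel f e a' u')).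
  apply: pgraph_inverse => [x y||].
  - exact: germ_rel_inv.
  - exact: (germ_rel_fun pi_etale soberB uu' au au').
  - exact: (germ_rel_fun pi_etale soberB u'u au' au).
have hh' : partial_inverse (pgraph (point_rel e f u)) (pgraph (point_rel f e u')).
  apply: pgraph_inverse => [x y||].
  - exact: point_rel_inv.
  - exact: (point_rel_fun soberB uu' au').
  - exact: (point_rel_fun soberB u'u au).
have th : is_ppaut pi (pgraph (germ_rel e f a u)) (pgraph (point_rel e f u)).
  by apply/(is_ppautP pi tt' hh'); split; apply: half_ppaut_rel; eassumption.
exists (PPAut th); split=> /=.
- exact: pdom_munn_index uu' _ _ au au'.
- move=> W; rewrite -(partial_inverse_dom uu') -(partial_inverse_dom hh').
  exact: pdom_munn_index u'u _ _ au' au W.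
- by move=> W W' b c uW /(point_relP uu' e au')[_ _ bc]; exact: bc uW.
- by move=> s s' x y as_ /(germ_relP uu' au au')[_ sy]; exact: sy as_.
Qed.

End TwoDirections.

End FromMunn.

(** * Each side of the correspondence determines the other *)

Section Uniqueness.
Context {X B : topologicalType} (pi : X -> B).
Local Notation Sec := (section_presheaf pi).
Implicit Types (m : munn Sec) (x : ppaut pi).

Definition munn_corresponds m x :=
  corresponds (munn_sections m) (munn_index m) (ppaut_total x) (ppaut_base x).

Lemma ppaut_half x : exists t' h',
  [/\ partial_inverse (ppaut_total x) t', partial_inverse (ppaut_base x) h',
      half_ppaut pi (ppaut_total x) (ppaut_base x) & half_ppaut pi t' h'].
Proof.
case: x => t h /= th.
have [U [V [_ _ /partial_homeo_inj tI /partial_homeo_inj hI _]]] := th.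
exists (pinv t), (pinv h); split; try exact: pinvP.
  by have [] := iffLR (is_ppautP pi (pinvP tI) (pinvP hI)) th.
by have [] := iffLR (is_ppautP pi (pinvP tI) (pinvP hI)) th.
Qed.

Lemma munn_half m : exists e, half_munn e (munn_sections m) (munn_index m).
Proof.
case: m => a u /= am; have [e0 [f0 [[_ _ aI _] [_ _ uI _] _]]] := am.
have [e [f [eau _]]] := iffLR (is_munnP (pinvP aI) (pinvP uI)) am.
by exists e.
Qed.

Lemma munn_section_dom m (s : Sec) :
  pdom (munn_sections m) s <-> pdom (munn_index m) (section_dom s).
Proof. by have [e [-> -> _ _ _]] := munn_half m. Qed.

Lemma munn_corresponds_open m x W W' : munn_corresponds m x ->
  munn_index m W = Some W' -> open_rel (ppaut_base x) W W'.
Proof.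
move=> [dE rE oc _] uW; split; [by apply/dE; exists W'|by apply/rE; exists W|].
by move=> b c; exact: oc.
Qed.

Lemma munn_corresponds_section m x (s s' : Sec) : munn_corresponds m x ->
  munn_sections m s = Some s' -> section_rel (ppaut_total x) (ppaut_base x) s s'.
Proof.
move=> mx ms; have [e [_ _ _ _ /(_ _ _ ms) us]] := munn_half m.
have [sd s'd _] := munn_corresponds_open mx us.
by have [_ _ _ sc] := mx; split=> // y z; exact: sc.
Qed.

(** Values of either element are constrained by the functional relations [open_rel] and
    [section_rel] of [x]. Domains agree because [ppaut_base x] fixes that of the index map, which in
    turn fixes that of the section map. *)
Lemma munn_corresponds_inj m m' x :
  munn_corresponds m x -> munn_corresponds m' x -> m = m'.
Proof.
have [t' [h' [tt' hh' th th']]] := ppaut_half x.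
suff half n n' : munn_corresponds n x -> munn_corresponds n' x ->
    (forall s s', munn_sections n s = Some s' -> munn_sections n' s = Some s') /\
    (forall W W', munn_index n W = Some W' -> munn_index n' W = Some W').
  move=> mx m'x; have [sl il] := half _ _ mx m'x; have [sr ir] := half _ _ m'x mx.
  apply: munn_eq; apply: peq => y z; first by split=> [/sl|/sr].
  by split=> [/il|/ir].
move=> nx n'x.
have domE W : pdom (munn_index n) W -> pdom (munn_index n') W.
  have [dn _ _ _] := nx; have [dn' _ _ _] := n'x.
  by move=> /dn /dn'.
split=> [s s' ns|W W' uW].
  have [r n's] : pdom (munn_sections n') s.
    by apply/munn_section_dom/domE/munn_section_dom; exists s'.
  rewrite n's; congr Some; apply: (section_rel_fun tt' hh' th').
    exact: munn_corresponds_section n'x n's.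
  exact: munn_corresponds_section nx ns.
have [V n'W] : pdom (munn_index n') W by apply: domE; exists W'.
rewrite n'W; congr Some; apply: (@open_rel_fun _ (ppaut_base x) W).
  exact: munn_corresponds_open n'x n'W.
exact: munn_corresponds_open nx uW.
Qed.

(** The part of [V] inside the open range of the base map is [munn_index m W] for some [W]. Hence
    [m] alone detects the neighbourhoods of [c]. *)
Lemma munn_corresponds_nbhs m x (V : opens B) b c : munn_corresponds m x ->
  ppaut_base x b = Some c -> (V : set B) c ->
  exists W W' : opens B, [/\ munn_index m W = Some W', (W : set B) b & (W' <= V)%O].
Proof.
move=> [_ rE oc _] hb Vc; have [t' [h' [_ hh' _ [h'o _ _ _ _]]]] := ppaut_half x.
have [W uW] : prange (munn_index m) (V `&` mk_opens h'o)%O.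
  by apply/rE; rewrite opens_meet -(partial_inverse_dom hh') => d [].
exists W, (V `&` mk_opens h'o)%O; split=> //; last exact: leIl.
by apply/(oc _ _ _ _ uW hb); split=> //; exists b; apply/hh'.
Qed.

(** The two images of a base point have the same open neighbourhoods, so soberness identifies them.
    The two images of a point [z] of [X] are then the value, at one base point, of the image of a
    section through [z]. *)
Lemma munn_corresponds_fun m x x' : local_homeomorphism pi -> sober B ->
  munn_corresponds m x -> munn_corresponds m x' -> x = x'.
Proof.
move=> piL sB.
suff half y y' : munn_corresponds m y -> munn_corresponds m y' ->
    (forall b c, ppaut_base y b = Some c -> ppaut_base y' b = Some c) /\
    (forall b c, ppaut_total y b = Some c -> ppaut_total y' b = Some c).
  move=> mx mx'; have [bl tl] := half _ _ mx mx'; have [br tr] := half _ _ mx' mx.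
  apply: ppaut_eq; apply: peq => w z; first by split=> [/tl|/tr].
  by split=> [/bl|/br].
move=> my my'; have [_ [_ [_ _ [ho _ _ _ tpi] _]]] := ppaut_half y.
have [_ [_ [_ _ [_ _ _ t'd t'pi] _]]] := ppaut_half y'.
have [dE _ oc sc] := my; have [dE' _ oc' sc'] := my'.
have half b c c' : ppaut_base y b = Some c -> ppaut_base y' b = Some c' -> c = c'.
  move=> hb h'b; apply: sober_kolmogorov => // V; split=> Vc.
    have [W [W' [uW Wb]]] := munn_corresponds_nbhs my hb Vc.
    by rewrite opens_le; apply; exact/(oc' _ _ _ _ uW h'b).
  have [W [W' [uW Wb]]] := munn_corresponds_nbhs my' h'b Vc.
  by rewrite opens_le; apply; exact/(oc _ _ _ _ uW hb).
have hE b c : ppaut_base y b = Some c -> ppaut_base y' b = Some c.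
  move=> hb; have [c' h'b] : pdom (ppaut_base y') b.
    by apply: (iffLR (dE' (mk_opens ho)) (iffRL (dE _) _)) => //; exists c.
  by rewrite h'b (half _ _ _ hb h'b).
split=> // z w tz; have hz := tpi _ _ tz.
have [w' t'z] : pdom (ppaut_total y') z.
  by rewrite t'd; exists (pi w); exact: hE.
have ww' : pi w' = pi w by have := t'pi _ _ t'z; rewrite (hE _ _ hz) => -[].
have [|s sz sd] := @section_through _ _ _ piL z (mk_opens ho); first by exists (pi w).
have [s' as_] : pdom (munn_sections m) (s : Sec).
  by apply/munn_section_dom/dE; move: sd; rewrite opens_le.
have := iffLR (sc' _ _ _ _ as_ t'z) sz; rewrite ww' (iffLR (sc _ _ _ _ as_ tz) sz).
by move=> [->].
Qed.

Lemma munn_corresponds_mul m m' x x' : munn_corresponds m x ->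
  munn_corresponds m' x' -> munn_corresponds (m * m')%g (x * x')%g.
Proof.
have mI (n : munn Sec) : pinjective (munn_index n).
  by case: n => a u /= [e [f [_ [_ _ ? _] _]]].
have xI (y : ppaut pi) : pinjective (ppaut_base y).
  by case: y => t h /= [U [V [_ _ _ /partial_homeo_inj]]].
by move=> mx m'x'; exact: corresponds_comp (mI m) (xI x) (mI m') (xI x') mx m'x'.
Qed.

End Uniqueness.

Theorem theoremF (X B : topologicalType) (pi : X -> B) :
  etale_bundle pi -> sober B ->
  inverse_semigroup_iso (munn (section_presheaf pi)) (ppaut pi).
Proof.
move=> pi_etale sB.
have /choice[phi phiP] := ppaut_of_munn pi_etale sB.
have /choice[psi psiP] := @munn_of_ppaut _ _ pi.
(* The image of the product and the product of the images both correspond to [m * m'], so uniqueness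
   identifies them. *)
have phiM : {morph phi : m m' / (m * m')%g}.
  move=> m m'; apply: (munn_corresponds_fun pi_etale.2 sB (phiP _)).
  exact: munn_corresponds_mul (phiP m) (phiP m').
pose phiH := isMultiplicative.Build _ _ phi phiM.
pose phi' : {multiplicative munn (section_presheaf pi) -> ppaut pi} :=
  HB.pack phi phiH.
exists phi', psi => [m|x].
- exact: (munn_corresponds_inj (psiP (phi m)) (phiP m)).
- exact: (munn_corresponds_fun pi_etale.2 sB (phiP (psi x)) (psiP x)).
Qed.
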